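(* Let $j,k\in\mathbb{J}_0$ and let $L_j=L_j^{p,q,r}(\alpha,\beta,\delta_\pm,\eta,\sigma,\theta,\tau)$ and $L_k=L_k^{p',q',r'}(\alpha',\beta',\delta'_\pm,\eta',\sigma',\theta',\tau')$ be $\mathcal{A}_{\lambda,\mu}$-modules. Then $$L_j\otimes L_k\simeq L_{j+k}^{\mathbf{p},\mathbf{q},\mathbf{r}}(\alpha^{\otimes},\beta^{\otimes},\delta_\pm^{\otimes},\eta^{\otimes},\sigma^{\otimes},\theta^{\otimes},\tau^{\otimes}),$$ where $\mathbf{p}=pp'+qq'+rr'$, $\mathbf{q}=pq'+qp'+rr'$, $\mathbf{r}=pr'+qr'+rp'+rq'+rr'$, and, with $b=b_jb_k$, the parameter matrices are $$\alpha^\otimes=\begin{pmatrix}b_j\boldsymbol{\alpha}'&\boldsymbol{\beta}&0\\ \boldsymbol{\alpha}&-b_j\boldsymbol{\beta}'&0\\0&0&\boldsymbol{\theta}-b\boldsymbol{\tau}'\end{pmatrix},\qquad \beta^\otimes=\begin{pmatrix}b_j\boldsymbol{\beta}'&\boldsymbol{\beta}&0\\ \boldsymbol{\alpha}&-b_j\boldsymbol{\alpha}'&0\\0&0&\boldsymbol{\theta}+b\boldsymbol{\tau}'\end{pmatrix},$$ $$\delta_+^\otimes=\begin{pmatrix}\boldsymbol{\delta}_+'&0&b_k^{-1}\boldsymbol{\delta}_+&0&0\\0&\boldsymbol{\delta}_-'&0&-b_k^{-1}\boldsymbol{\delta}_-&0\\ \boldsymbol{\eta}&-\boldsymbol{\sigma}&-b_j\boldsymbol{\eta}'&-b_j\boldsymbol{\sigma}'&-b_k^{-1}(\boldsymbol{\tau}-\boldsymbol{\theta}')\end{pmatrix},$$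 $$\delta_-^\otimes=\begin{pmatrix}\boldsymbol{\delta}_-'&0&0&-b_k^{-1}\boldsymbol{\delta}_+&0\\0&\boldsymbol{\delta}_+'&b_k^{-1}\boldsymbol{\delta}_-&0&0\\ \boldsymbol{\eta}&-\boldsymbol{\sigma}&-b_j\boldsymbol{\eta}'&-b_j\boldsymbol{\sigma}'&b_k^{-1}(\boldsymbol{\tau}-\boldsymbol{\theta}')\end{pmatrix},$$ $$\eta^\otimes=\begin{pmatrix}b_j\boldsymbol{\eta}'&0&\frac{b_k^{-1}}{2}\boldsymbol{\delta}_+\\0&-b_j\boldsymbol{\sigma}'&\frac{b_k^{-1}}{2}\boldsymbol{\delta}_-\\ \boldsymbol{\eta}&0&-\frac12\boldsymbol{\delta}_+'\\0&\boldsymbol{\sigma}&\frac12\boldsymbol{\delta}_-'\\0&0&-\frac{b_j}{2}(\boldsymbol{\tau}+\boldsymbol{\theta}')\end{pmatrix},\qquad \sigma^\otimes=\begin{pmatrix}b_j\boldsymbol{\sigma}'&0&-\frac{b_k^{-1}}{2}\boldsymbol{\delta}_+\\0&-b_j\boldsymbol{\eta}'&-\frac{b_k^{-1}}{2}\boldsymbol{\delta}_-\\0&\boldsymbol{\sigma}&\frac12\boldsymbol{\delta}_+'\\ \boldsymbol{\eta}&0&-\frac12\boldsymbol{\delta}_-'\\0&0&-\frac{b_j}{2}(\boldsymbol{\tau}+\boldsymbol{\theta}')\end{pmatrix},$$ $$\theta^\otimes=\begin{pmatrix}b_j\boldsymbol{\theta}'&\boldsymbol{\beta}&0&0&0\\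 \boldsymbol{\alpha}&-b_j\boldsymbol{\theta}'&0&0&0\\0&0&\boldsymbol{\theta}&0&\boldsymbol{\delta}_+'\\0&0&0&\boldsymbol{\theta}&\boldsymbol{\delta}_-'\\0&0&-b_jb\boldsymbol{\eta}'&b_jb\boldsymbol{\sigma}'&-\boldsymbol{\theta}\end{pmatrix},\qquad \tau^\otimes=\begin{pmatrix}\boldsymbol{\tau}'&0&0&0&-b_k^{-1}b^{-1}\boldsymbol{\delta}_+\\0&\boldsymbol{\tau}'&0&0&b_k^{-1}b^{-1}\boldsymbol{\delta}_-\\0&0&b_k^{-1}\boldsymbol{\tau}&-b_k^{-1}\boldsymbol{\beta}'&0\\0&0&b_k^{-1}\boldsymbol{\alpha}'&-b_k^{-1}\boldsymbol{\tau}&0\\-\boldsymbol{\eta}&-\boldsymbol{\sigma}&0&0&-\boldsymbol{\tau}'\end{pmatrix}.$$ Here, for each unprimed parameter $m$ and each primed parameter $m'$, $\boldsymbol{m}=m\otimes\mathrm{id}$ and $\boldsymbol{m}'=\mathrm{id}\otimes m'$ (Kronecker products with identity matrices of the appropriate sizes).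
   Context: $\Bbbk$ is an algebraically closed field of characteristic zero, $\ell>1$, $\lambda,\mu\in\Bbbk$. $\mathbb{G}_{3,\ell}=\langle s,t\mid s^3=t^{2\ell}=1,\ ts=s^2t\rangle$. $\mathcal{A}_{\lambda,\mu}$ is the Hopf algebra generated by $\Bbbk\mathbb{G}_{3,\ell}$ and $a_0,a_1,a_2$ (indices mod 3) with relations $ta_i=-a_{-i}t$, $sa_i=a_{i+1}s$, $a_0^2=a_1^2=a_2^2=\mu(1-t^2)$, $a_0a_1+a_1a_2+a_2a_0=\lambda(1-st^2)$, $a_1a_0+a_2a_1+a_0a_2=\lambda(1-s^2t^2)$, group elements being group-like and $\Delta(a_i)=a_i\otimes1+s^{-i}t\otimes a_i$. It is generated as an algebra by $a_0,s,t$. $\xi,\zeta\in\Bbbk$ are primitive roots of 1 of orders $3,\ell$; $\mathbb{J}_0=\{0,\dots,\ell-1\}$; $b_j$ is a fixed scalar with $b_j^2=\zeta^j$, $b_0=1$. Module notation: given $j\in\mathbb{J}_0$, a square root $b$ of $\zeta^j$, and $p,q,r\ge0$, the module $L_j^{p,q,r}(\alpha,\beta,\delta_\pm,\eta,\sigma,\theta,\tau)$, with $\alpha\in\Bbbk^{q\times p}$, $\beta\in\Bbbk^{p\times q}$, $\delta_+\in\Bbbk^{p\times r}$, $\delta_-\in\Bbbk^{q\times r}$, $\eta\in\Bbbk^{r\times p}$, $\sigma\in\Bbbk^{r\times q}$, $\theta,\tau\in\Bbbk^{r\times r}$, has basis $x=(x_1,\dots,x_p)^t$, $y=(y_1,\dots,y_q)^t$,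 $v=(v_1,\dots,v_r)^t$, $w=(w_1,\dots,w_r)^t$ with $sx_i=x_i$, $tx_i=bx_i$, $sy_i=y_i$, $ty_i=-by_i$, $sv_i=\xi v_i$, $sw_i=\xi^2w_i$, $tv_i=w_i$, $tw_i=\zeta^jv_i$, and $a_0x=\beta y-b\delta_+v+\delta_+w$, $a_0y=\alpha x+b\delta_-v+\delta_-w$, $a_0v=\eta x+\sigma y+\theta v+\tau w$, $a_0w=-b\eta x+b\sigma y-\zeta^j\tau v-\theta w$; the matrices are required to be such that this defines an $\mathcal{A}_{\lambda,\mu}$-module. For $L_j$ and $L_k$ the square roots used are $b_j$ and $b_k$; for the module $L_{j+k}$ (index mod $\ell$) the square root used is $b=b_jb_k$. The block decompositions refer to the following ordered bases of $L_j\otimes L_k$, where $x,y,v,w$ and $x',y',v',w'$ denote the bases of $L_j$ and $L_k$: $S^+$-part: $x\otimes x'$, $y\otimes y'$, $b_jv\otimes w'+b_kw\otimes v'$; $S^-$-part: $x\otimes y'$, $y\otimes x'$, $b_jv\otimes w'-b_kw\otimes v'$; $v$-part: $x\otimes v'$, $y\otimes v'$, $v\otimes x'$, $v\otimes y'$, $w\otimes w'$; $w$-part: $b_jx\otimes w'$, $-b_jy\otimes w'$, $b_kw\otimes x'$, $-b_kw\otimes y'$, $(b_jb_k)^2v\otimes v'$. *)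

(* Defs.v *)
From HB Require Import structures.
From mathcomp Require Import all_boot all_order all_algebra.
From mathcomp Require Import generic_quotient boolp.
From mathcomp Require Import mxtens.

Set Implicit Arguments.
Unset Strict Implicit.
Unset Printing Implicit Defensive.

Import GRing.Theory.
Local Open Scope ring_scope.
Local Open Scope quotient_scope.

Declare Scope pterm_scope.
Delimit Scope pterm_scope with P.

(* Noncommutative polynomial expressions in the generators [G]. *)
Inductive pterm (k G : Type) : Type :=
| PConst of k
| PGen of G
| PAdd of pterm k G & pterm k G
| PMul of pterm k G & pterm k G.

Arguments PConst {k G}.
Arguments PGen {k G}.
Bind Scope pterm_scope with pterm.

HB.instance Definition _ (k G : Type) := gen_eqMixin (pterm k G).
HB.instance Definition _ (k G : Type) := gen_choiceMixin (pterm k G).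

Definition ppow (k : fieldType) (G : Type) (u : pterm k G) (n : nat) :=
  iter n (PMul u) (PConst 1).

Notation "u + v" := (PAdd u v) : pterm_scope.
Notation "u * v" := (PMul u v) : pterm_scope.
Notation "u ^+ n" := (ppow u n) : pterm_scope.
Notation "c %:P" := (PConst c) : pterm_scope.
Notation "- u" := (PMul (PConst (-1)) u) : pterm_scope.
Notation "u - v" := (u + - v)%P : pterm_scope.

Section Eval.
Variables (k : fieldType) (G : Type) (B : pzRingType).
Variables (phi : k -> B) (f : G -> B).

Fixpoint peval (u : pterm k G) : B :=
  match u with
  | PConst c => phi c
  | PGen g => f g
  | PAdd u v => peval u + peval v
  | PMul u v => peval u * peval v
  end.

End Eval.

(* The least congruence containing [R] modulo which expressions form an
   associative unital k-algebra. *)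
Section Congruence.
Variables (k : fieldType) (G : Type) (R : pterm k G -> pterm k G -> Prop).

Inductive peqv : pterm k G -> pterm k G -> Prop :=
| Eqv_rel u v : R u v -> peqv u v
| Eqv_refl u : peqv u u
| Eqv_sym u v : peqv u v -> peqv v u
| Eqv_trans u v w : peqv u v -> peqv v w -> peqv u w
| Eqv_add u u' v v' : peqv u u' -> peqv v v' -> peqv (u + v) (u' + v')
| Eqv_mul u u' v v' : peqv u u' -> peqv v v' -> peqv (u * v) (u' * v')
| Eqv_addA u v w : peqv (u + (v + w)) ((u + v) + w)
| Eqv_addC u v : peqv (u + v) (v + u)
| Eqv_add0 u : peqv (0%:P + u) u
| Eqv_addN u : peqv (- u + u) (0%:P)
| Eqv_mulA u v w : peqv (u * (v * w)) ((u * v) * w)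
| Eqv_mul1 u : peqv (1%:P * u) u
| Eqv_mulDl u v w : peqv ((u + v) * w) (u * w + v * w)
| Eqv_mulDr u v w : peqv (u * (v + w)) (u * v + u * w)
| Eqv_constD c d : peqv ((c + d)%R%:P) (c%:P + d%:P)
| Eqv_constM c d : peqv ((c * d)%R%:P) (c%:P * d%:P)
| Eqv_constC c u : peqv (c%:P * u) (u * c%:P).

Definition peqvb u v := `[< peqv u v >].

Lemma peqvb_refl : reflexive peqvb.
Proof. by move=> u; apply/asboolP; apply: Eqv_refl. Qed.
Lemma peqvb_sym : symmetric peqvb.
Proof. by move=> u v; apply/asboolP/asboolP; apply: Eqv_sym. Qed.
Lemma peqvb_trans : transitive peqvb.
Proof. by move=> v u w /asboolP uv /asboolP vw; apply/asboolP; apply: Eqv_trans uv vw. Qed.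

Canonical peqvb_equiv := EquivRel peqvb peqvb_refl peqvb_sym peqvb_trans.

End Congruence.

(* A presentation of an augmented algebra.  The augmentation (for Hopf algebras,
   the counit) guarantees that the presented algebra is not the zero ring. *)
Record presentation (k : fieldType) := Presentation {
  pgens : Type;
  prels : pterm k pgens -> pterm k pgens -> Prop;
  paug : pgens -> k;
  paugP : forall u v, prels u v -> peval (@id k) paug u = peval (@id k) paug v
}.

Section PresentedAlgebra.
Variables (k : fieldType) (P : presentation k).
Local Notation term := (pterm k (pgens P)).
Local Notation eqv := (peqv (prels (p := P))).

Definition palg := {eq_quot (peqvb_equiv (prels (p := P)))}.

HB.instance Definition _ := Choice.on palg.

Local Notation pi u := (\pi_palg (u : term) : palg)%qT.

Lemma palgP (u v : term) : (pi u = pi v) <-> eqv u v.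
Proof. by split=> [/eqquotP/asboolP//|uv]; apply/eqquotP/asboolP. Qed.

Lemma repr_eqv (u : term) : eqv (repr (pi u)) u.
Proof. by apply/palgP; rewrite reprK. Qed.

Lemma palg_pi (x : palg) : exists u, x = pi u.
Proof. by exists (repr x); rewrite reprK. Qed.

Definition palg_zero : palg := pi 0%:P%P.
Definition palg_one : palg := pi 1%:P%P.
Definition palg_add (x y : palg) : palg := pi (repr x + repr y)%P.
Definition palg_mul (x y : palg) : palg := pi (repr x * repr y)%P.
Definition palg_opp (x : palg) : palg := pi (- repr x)%P.
Definition palg_scale (c : k) (x : palg) : palg := pi (c%:P * repr x)%P.

Lemma pi_add u v : palg_add (pi u) (pi v) = pi (u + v)%P.
Proof. by apply/palgP/Eqv_add; apply: repr_eqv. Qed.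
Lemma pi_mul u v : palg_mul (pi u) (pi v) = pi (u * v)%P.
Proof. by apply/palgP/Eqv_mul; apply: repr_eqv. Qed.
Lemma pi_opp u : palg_opp (pi u) = pi (- u)%P.
Proof. by apply/palgP/Eqv_mul; [apply: Eqv_refl|apply: repr_eqv]. Qed.
Lemma pi_scale c u : palg_scale c (pi u) = pi (c%:P * u)%P.
Proof. by apply/palgP/Eqv_mul; [apply: Eqv_refl|apply: repr_eqv]. Qed.

Lemma palg_addA : associative palg_add.
Proof.
move=> x y z; have [[[u ->] [v ->]] [w ->]] := (palg_pi x, palg_pi y, palg_pi z).
by rewrite !pi_add; apply/palgP/Eqv_addA.
Qed.
Lemma palg_addC : commutative palg_add.
Proof.
move=> x y; have [[u ->] [v ->]] := (palg_pi x, palg_pi y).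
by rewrite !pi_add; apply/palgP/Eqv_addC.
Qed.
Lemma palg_add0 : left_id palg_zero palg_add.
Proof.
move=> x; have [u ->] := palg_pi x.
by rewrite !pi_add; apply/palgP/Eqv_add0.
Qed.
Lemma palg_addN : left_inverse palg_zero palg_opp palg_add.
Proof.
move=> x; have [u ->] := palg_pi x.
by rewrite !pi_opp !pi_add; apply/palgP/Eqv_addN.
Qed.

HB.instance Definition _ := GRing.isZmodule.Build palg
  palg_addA palg_addC palg_add0 palg_addN.

Lemma palg_mulA : associative palg_mul.
Proof.
move=> x y z; have [[[u ->] [v ->]] [w ->]] := (palg_pi x, palg_pi y, palg_pi z).
by rewrite !pi_mul; apply/palgP/Eqv_mulA.
Qed.
Lemma palg_mul1l : left_id palg_one palg_mul.
Proof.
move=> x; have [u ->] := palg_pi x.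
by rewrite !pi_mul; apply/palgP/Eqv_mul1.
Qed.
Lemma palg_mul1r : right_id palg_one palg_mul.
Proof.
move=> x; have [u ->] := palg_pi x; rewrite !pi_mul; apply/palgP.
by apply: Eqv_trans (Eqv_mul1 _ _); apply/Eqv_sym/Eqv_constC.
Qed.
Lemma palg_mulDl : left_distributive palg_mul palg_add.
Proof.
move=> x y z; have [[[u ->] [v ->]] [w ->]] := (palg_pi x, palg_pi y, palg_pi z).
by rewrite !(pi_add, pi_mul); apply/palgP/Eqv_mulDl.
Qed.
Lemma palg_mulDr : right_distributive palg_mul palg_add.
Proof.
move=> x y z; have [[[u ->] [v ->]] [w ->]] := (palg_pi x, palg_pi y, palg_pi z).
by rewrite !(pi_add, pi_mul); apply/palgP/Eqv_mulDr.
Qed.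
Lemma peqv_aug u v :
  eqv u v -> peval (@id k) (paug (p := P)) u = peval (@id k) (paug (p := P)) v.
Proof.
elim=> {u v} //=.
- exact: paugP.
- by move=> u v w _ -> _ ->.
- by move=> u u' v v' _ -> _ ->.
- by move=> u u' v v' _ -> _ ->.
- by move=> u v w; rewrite addrA.
- by move=> u v; rewrite addrC.
- by move=> u; rewrite add0r.
- by move=> u; rewrite mulN1r addNr.
- by move=> u v w; rewrite mulrA.
- by move=> u; rewrite mul1r.
- by move=> u v w; rewrite mulrDl.
- by move=> u v w; rewrite mulrDr.
- by move=> c u; rewrite mulrC.
Qed.
Lemma palg_one_neq0 : palg_one != 0.
Proof. by apply/eqP => /palgP/peqv_aug /= /eqP; rewrite oner_eq0. Qed.

HB.instance Definition _ := GRing.Zmodule_isNzRing.Build palg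
  palg_mulA palg_mul1l palg_mul1r palg_mulDl palg_mulDr palg_one_neq0.

Lemma palg_addE u v : pi u + pi v = pi (u + v)%P.
Proof. exact: pi_add. Qed.
Lemma palg_mulE u v : pi u * pi v = pi (u * v)%P.
Proof. exact: pi_mul. Qed.

Lemma palg_scaleA a b x : palg_scale a (palg_scale b x) = palg_scale (a * b) x.
Proof.
have [u ->] := palg_pi x; rewrite !pi_scale; apply/palgP.
apply: Eqv_trans (Eqv_mulA _ _ _ _) _.
by apply: Eqv_mul; [apply/Eqv_sym/Eqv_constM|apply: Eqv_refl].
Qed.
Lemma palg_scale1 : left_id 1 palg_scale.
Proof. by move=> x; have [u ->] := palg_pi x; rewrite pi_scale; apply/palgP/Eqv_mul1. Qed.
Lemma palg_scaleDr : right_distributive palg_scale +%R.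
Proof.
move=> c x y; have [[u ->] [v ->]] := (palg_pi x, palg_pi y).
by rewrite !(palg_addE, pi_scale); apply/palgP/Eqv_mulDr.
Qed.
Lemma palg_scaleDl x : {morph palg_scale^~ x : a b / a + b}.
Proof.
move=> a b; have [u ->] := palg_pi x.
rewrite /= !(pi_scale, palg_addE); apply/palgP.
apply: Eqv_trans (Eqv_mulDl _ _ _ _).
by apply: Eqv_mul; [apply: Eqv_constD|apply/Eqv_sym/repr_eqv].
Qed.

HB.instance Definition _ := GRing.Zmodule_isLmodule.Build k palg
  palg_scaleA palg_scale1 palg_scaleDr palg_scaleDl.

Lemma palg_scaleE c u : c *: pi u = pi (c%:P * u)%P.
Proof. exact: pi_scale. Qed.

Lemma palg_scalerAl (c : k) (x y : palg) : c *: (x * y) = (c *: x) * y.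
Proof.
have [[u ->] [v ->]] := (palg_pi x, palg_pi y).
rewrite palg_mulE !palg_scaleE palg_mulE; apply/palgP/Eqv_mulA.
Qed.

HB.instance Definition _ := GRing.Lmodule_isLalgebra.Build k palg palg_scalerAl.

Lemma palg_scalerAr (c : k) (x y : palg) : c *: (x * y) = x * (c *: y).
Proof.
have [[u ->] [v ->]] := (palg_pi x, palg_pi y).
rewrite palg_mulE !palg_scaleE palg_mulE; apply/palgP.
apply: Eqv_trans (Eqv_mulA _ _ _ _) _.
apply: Eqv_trans (Eqv_sym (Eqv_mulA _ _ _ _)).
by apply: Eqv_mul; [apply: Eqv_constC|apply: Eqv_refl].
Qed.

HB.instance Definition _ := GRing.Lalgebra_isAlgebra.Build k palg palg_scalerAr.

Definition pgen (g : pgens P) : palg := pi (PGen g).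

Lemma palg_constE c : c%:A = pi c%:P%P.
Proof.
have -> : c%:A = palg_scale c palg_one by [].
by rewrite pi_scale; apply/palgP; apply: Eqv_trans (Eqv_constC _ _ _) (Eqv_mul1 _ _).
Qed.

Lemma peval_pgen u : peval (in_alg palg) pgen u = pi u.
Proof.
elim: u => [c|g|u IHu v IHv|u IHu v IHv] //=; first exact: palg_constE.
- by rewrite IHu IHv palg_addE.
- by rewrite IHu IHv palg_mulE.
Qed.

Lemma palg_rel u v : prels u v ->
  peval (in_alg palg) pgen u = peval (in_alg palg) pgen v.
Proof. by move=> uv; rewrite !peval_pgen; apply/palgP/Eqv_rel. Qed.

Lemma palg_ind (K : palg -> Prop) :
  (forall c : k, K c%:A) -> (forall g, K (pgen g)) ->
  (forall x y, K x -> K y -> K (x + y)) ->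
  (forall x y, K x -> K y -> K (x * y)) -> forall x, K x.
Proof.
move=> Kc Kg Ka Km x; have [u ->] := palg_pi x; rewrite -peval_pgen.
elim: u => [c|g|u IHu v IHv|u IHu v IHv] //=.
- exact: Ka.
- exact: Km.
Qed.

Section Lift.
Variables (B : pzRingType) (phi : {rmorphism k -> B}) (f : pgens P -> B).
Hypothesis phiC : forall c b, phi c * b = b * phi c.
Hypothesis fP : forall u v, prels u v -> peval phi f u = peval phi f v.

Definition plift_fun (x : palg) : B := peval phi f (repr x).

Lemma peqv_peval u v : eqv u v -> peval phi f u = peval phi f v.
Proof.
elim=> {u v} //=.
- by move=> u v w _ -> _ ->.
- by move=> u u' v v' _ -> _ ->.
- by move=> u u' v v' _ -> _ ->.
- by move=> u v w; rewrite addrA.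
- by move=> u v; rewrite addrC.
- by move=> u; rewrite rmorph0 add0r.
- by move=> u; rewrite rmorphN1 rmorph0 mulN1r addNr.
- by move=> u v w; rewrite mulrA.
- by move=> u; rewrite rmorph1 mul1r.
- by move=> u v w; rewrite mulrDl.
- by move=> u v w; rewrite mulrDr.
- by move=> c d; rewrite rmorphD.
- by move=> c d; rewrite rmorphM.
Qed.

Lemma plift_pi u : plift_fun (pi u) = peval phi f u.
Proof. exact/peqv_peval/repr_eqv. Qed.

Lemma plift_is_nmod_morphism : nmod_morphism plift_fun.
Proof.
split=> [|x y]; first by rewrite -[0]/(pi 0%:P%P) plift_pi /= rmorph0.
have [[u ->] [v ->]] := (palg_pi x, palg_pi y).
by rewrite palg_addE !plift_pi.
Qed.

Lemma plift_is_monoid_morphism : monoid_morphism plift_fun.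
Proof.
split=> [|x y]; first by rewrite -[1]/(pi 1%:P%P) plift_pi /= rmorph1.
have [[u ->] [v ->]] := (palg_pi x, palg_pi y).
by rewrite palg_mulE !plift_pi.
Qed.

Lemma plift_scale c x : plift_fun (c *: x) = phi c * plift_fun x.
Proof. by have [u ->] := palg_pi x; rewrite palg_scaleE !plift_pi. Qed.

Lemma plift_pgen g : plift_fun (pgen g) = f g.
Proof. exact: plift_pi. Qed.

End Lift.

End PresentedAlgebra.

Definition alg_lift (k : fieldType) (P : presentation k) (B : algType k)
    (f : pgens P -> B)
    (_ : forall u v, prels u v ->
           peval (in_alg B) f u = peval (in_alg B) f v) : palg P -> B :=
  plift_fun (in_alg B) f.

Definition mx_lift (k : fieldType) (P : presentation k) (n : nat)
    (f : pgens P -> 'M[k]_n)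
    (_ : forall u v, prels u v ->
           peval scalar_mx f u = peval scalar_mx f v) : palg P -> 'M[k]_n :=
  plift_fun scalar_mx f.

Section Lifts.
Variables (k : fieldType) (P : presentation k).

Section Alg.
Variables (B : algType k) (f : pgens P -> B).
Hypothesis fP :
  forall u v, prels u v -> peval (in_alg B) f u = peval (in_alg B) f v.

Let phiC (c : k) (b : B) : in_alg B c * b = b * in_alg B c.
Proof. by rewrite /= -scalerAl -scalerAr mul1r mulr1. Qed.

Lemma alg_lift_scalable : scalable (alg_lift fP).
Proof. by move=> c x; rewrite /alg_lift plift_scale //= -scalerAl mul1r. Qed.

HB.instance Definition _ := GRing.isNmodMorphism.Build (palg P) B (alg_lift fP)
  (plift_is_nmod_morphism phiC fP).
HB.instance Definition _ := GRing.isMonoidMorphism.Build (palg P) B (alg_lift fP)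
  (plift_is_monoid_morphism phiC fP).
HB.instance Definition _ := GRing.isScalable.Build k (palg P) B *:%R (alg_lift fP)
  alg_lift_scalable.

Lemma alg_lift_pgen g : alg_lift fP (pgen g) = f g.
Proof. exact: plift_pgen phiC fP g. Qed.
End Alg.

Section Mx.
Variables (n : nat) (f : pgens P -> 'M[k]_n).
Hypothesis fP :
  forall u v, prels u v -> peval scalar_mx f u = peval scalar_mx f v.

Let phiC (c : k) (b : 'M[k]_n) : c%:M * b = b * c%:M.
Proof. by apply/esym/scalar_mxC. Qed.

Lemma mx_lift_scalable : scalable (mx_lift fP).
Proof.
move=> c x; rewrite /mx_lift (plift_scale (phi := scalar_mx) phiC fP).
exact: mul_scalar_mx.
Qed.

HB.instance Definition _ := GRing.isNmodMorphism.Build (palg P) 'M[k]_n (mx_lift fP)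
  (plift_is_nmod_morphism (phi := scalar_mx) phiC fP).
HB.instance Definition _ := GRing.isMonoidMorphism.Build (palg P) 'M[k]_n (mx_lift fP)
  (plift_is_monoid_morphism (phi := scalar_mx) phiC fP).
HB.instance Definition _ := GRing.isScalable.Build k (palg P) 'M[k]_n *:%R (mx_lift fP)
  mx_lift_scalable.

Lemma mx_lift_pgen g : mx_lift fP (pgen g) = f g.
Proof. exact: (plift_pgen (phi := scalar_mx) phiC fP g). Qed.
End Mx.
End Lifts.

(* A finite-dimensional left module with underlying space the columns 'cV_n. *)
Notation module P n := {lrmorphism palg P -> 'M_n}.

Definition module_iso (k : fieldType) (P : presentation k) (m n : nat)
    (V : module P m) (W : module P n) : Prop :=
  exists (f : 'M[k]_(n, m)) (g : 'M[k]_(m, n)),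
    [/\ g *m f = 1%:M, f *m g = 1%:M & forall x, f *m V x = W x *m f].

Lemma tensmx11 (R : comPzRingType) m n :
  (1%:M : 'M[R]_m) *t (1%:M : 'M[R]_n) = 1%:M.
Proof.
apply/matrixP=> i j; case: (mxtens_indexP i) => i0 i1; case: (mxtens_indexP j) => j0 j1.
rewrite tensmxE !mxE (can_eq (@mxtens_indexK m n)) xpair_eqE.
by rewrite -natrM mulnb.
Qed.

(* The tensor product of two algebras, presented by commuting copies of both. *)
Section TensorAlgebra.
Variables (k : fieldType) (P Q : presentation k).
Local Notation gens := (palg P + palg Q)%type.
Local Notation lft x := (@PGen k gens (inl x)).
Local Notation rgt y := (@PGen k gens (inr y)).

Inductive tens_rel : pterm k gens -> pterm k gens -> Prop :=
| Tens_lD (x x' : palg P) : tens_rel (lft (x + x')%R) (lft x + lft x')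
| Tens_lM (x x' : palg P) : tens_rel (lft (x * x')%R) (lft x * lft x')
| Tens_lC (c : k) : tens_rel (lft (c%:A)%R) (c%:P)
| Tens_rD (y y' : palg Q) : tens_rel (rgt (y + y')%R) (rgt y + rgt y')
| Tens_rM (y y' : palg Q) : tens_rel (rgt (y * y')%R) (rgt y * rgt y')
| Tens_rC (c : k) : tens_rel (rgt (c%:A)%R) (c%:P)
| Tens_comm x y : tens_rel (lft x * rgt y) (rgt y * lft x).

End TensorAlgebra.

Section Counit.
Variables (k : fieldType) (P : presentation k).

Lemma counit_subproof u v : prels u v ->
  peval (in_alg k^o) (paug (p := P)) u = peval (in_alg k^o) (paug (p := P)) v.
Proof.
have E w : peval (in_alg k^o) (paug (p := P)) w = peval (@id k) (paug (p := P)) w.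
  elim: w => [c|g|w IHw w' IHw'|w IHw w' IHw'] //=; last 2 first.
  - by rewrite IHw IHw'.
  - by rewrite IHw IHw'.
  by rewrite /GRing.scale /= mulr1.
by rewrite !E; apply: paugP.
Qed.

Definition counit : {lrmorphism palg P -> k^o} := alg_lift counit_subproof.

Lemma counit_alg c : counit c%:A = c.
Proof. by rewrite linearZ rmorph1; apply: mulr1. Qed.
End Counit.

Section TensorAlgebra2.
Variables (k : fieldType) (P Q : presentation k).

Definition tens_aug (g : palg P + palg Q) : k :=
  match g with inl x => counit P x | inr y => counit Q y end.

Lemma tens_augP u v : tens_rel u v ->
  peval (@id k) tens_aug u = peval (@id k) tens_aug v.
Proof.
by case=> *; first [exact: rmorphD | exact: rmorphM | exact: mulrC
  | exact: counit_alg].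
Qed.

Definition tens_pres : presentation k := Presentation tens_augP.

Definition tens (x : palg P) (y : palg Q) : palg tens_pres :=
  @pgen k tens_pres (inl x) * @pgen k tens_pres (inr y).

(* [V (x) W] as a module over the tensor product of the two algebras. *)
Section ExternalTensor.
Variables (m n : nat) (V : module P m) (W : module Q n).

Definition tens_act (g : palg P + palg Q) : 'M[k]_(m * n) :=
  match g with inl x => V x *t 1%:M | inr y => 1%:M *t W y end.

Lemma tens_actP u v : tens_rel u v ->
  peval scalar_mx tens_act u = peval scalar_mx tens_act v.
Proof.
have mxl p (A A' : 'M[k]_p) q (B : 'M[k]_q) : (A + A') *t B = A *t B + A' *t B.
  by apply/matrixP=> i j; rewrite !mxE mulrDl.
have mxr p (A : 'M[k]_p) q (B B' : 'M[k]_q) : A *t (B + B') = A *t B + A *t B'.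
  by apply/matrixP=> i j; rewrite !mxE mulrDr.
have mxZl p q (c : k) (A : 'M[k]_p) (B : 'M[k]_q) : (c *: A) *t B = c *: (A *t B).
  by apply/matrixP=> i j; rewrite !mxE mulrA.
have mxZr p q (c : k) (A : 'M[k]_p) (B : 'M[k]_q) : A *t (c *: B) = c *: (A *t B).
  by apply/matrixP=> i j; rewrite !mxE mulrCA.
case=> [x x'|x x'|c|y y'|y y'|c|x y] /=.
- by rewrite rmorphD mxl.
- by rewrite rmorphM /= [RHS]tensmx_mul mulmx1.
- by rewrite linearZ /= !rmorph1 mxZl -[RHS]scalemx1; congr (_ *: _); exact: (tensmx11 k m n).
- by rewrite rmorphD mxr.
- by rewrite rmorphM /= [RHS]tensmx_mul mulmx1.
- by rewrite linearZ /= !rmorph1 mxZr -[RHS]scalemx1; congr (_ *: _); exact: (tensmx11 k m n).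
- by rewrite [LHS]tensmx_mul [RHS]tensmx_mul !mulmx1 !mul1mx.
Qed.

Definition tens_module : module tens_pres (m * n) := mx_lift (P := tens_pres) tens_actP.

Lemma tens_moduleE x y : tens_module (tens x y) = V x *t W y.
Proof.
rewrite rmorphM /= !(mx_lift_pgen (P := tens_pres) tens_actP) /=.
by rewrite [LHS]tensmx_mul mulmx1 mul1mx.
Qed.
End ExternalTensor.

Lemma tensM x x' y y' : tens x y * tens x' y' = tens (x * x') (y * y').
Proof.
have lM := @palg_rel k tens_pres _ _ (Tens_lM Q x x').
have rM := @palg_rel k tens_pres _ _ (Tens_rM P y y').
have cm := @palg_rel k tens_pres _ _ (Tens_comm x' y).
rewrite /= in lM rM cm; rewrite /tens lM rM -!mulrA; congr (_ * _).
by rewrite !mulrA -cm.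
Qed.
Lemma tensDl x x' y : tens (x + x') y = tens x y + tens x' y.
Proof. by have /= E := @palg_rel k tens_pres _ _ (Tens_lD Q x x'); rewrite /tens E mulrDl. Qed.
Lemma tensDr x y y' : tens x (y + y') = tens x y + tens x y'.
Proof. by have /= E := @palg_rel k tens_pres _ _ (Tens_rD P y y'); rewrite /tens E mulrDr. Qed.
Lemma tens_algl c y : tens c%:A y = c *: tens 1 y.
Proof.
have E d := @palg_rel k tens_pres _ _ (Tens_lC P Q d).
rewrite /= in E; rewrite /tens E -[1 in RHS]scale1r E scale1r mul1r.
by rewrite -scalerAl mul1r.
Qed.
Lemma tens_algr x c : tens x c%:A = c *: tens x 1.
Proof.
have E d := @palg_rel k tens_pres _ _ (Tens_rC P Q d).
rewrite /= in E; rewrite /tens E -[1 in RHS]scale1r E scale1r mulr1.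
by rewrite -scalerAr mulr1.
Qed.
Lemma tensZl c x y : tens (c *: x) y = c *: tens x y.
Proof.
have -> : c *: x = c%:A * x by rewrite -scalerAl mul1r.
by rewrite -[y in LHS]mul1r -tensM tens_algl -scalerAl tensM !mul1r.
Qed.
Lemma tensZr c x y : tens x (c *: y) = c *: tens x y.
Proof.
have -> : c *: y = c%:A * y by rewrite -scalerAl mul1r.
by rewrite -[x in LHS]mul1r -tensM tens_algr -scalerAl tensM !mul1r.
Qed.
Lemma tens11 : tens 1 1 = 1.
Proof.
have E1 := @palg_rel k tens_pres _ _ (Tens_lC P Q 1).
have E2 := @palg_rel k tens_pres _ _ (Tens_rC P Q 1).
by rewrite /= !scale1r in E1 E2; rewrite /tens E1 E2 mulr1.
Qed.

Lemma tensNl x y : tens (- x) y = - tens x y.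
Proof. by rewrite -scaleN1r tensZl scaleN1r. Qed.
Lemma tensNr x y : tens x (- y) = - tens x y.
Proof. by rewrite -scaleN1r tensZr scaleN1r. Qed.
Lemma tensX x y n : tens x y ^+ n = tens (x ^+ n) (y ^+ n).
Proof.
elim: n => [|n IHn]; first by rewrite !expr0 tens11.
by rewrite !exprS IHn tensM.
Qed.

End TensorAlgebra2.

(* Generators and relations of A_(lambda, mu) over the group G_(3, l);
   the relations involving only s and t are those of the group. *)
Inductive hgen : Type := Gs | Gt | Ga of 'Z_3.

Section HopfAlgebra.
Variables (k : fieldType) (l : nat) (lam mu : k).

Local Notation s := (@PGen k hgen Gs).
Local Notation t := (@PGen k hgen Gt).
Local Notation a i := (@PGen k hgen (Ga i)).

Inductive hrel : pterm k hgen -> pterm k hgen -> Prop :=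
| Hrel_s3 : hrel (s ^+ 3) (1%:P)
| Hrel_t2l : hrel (t ^+ (2 * l)%N) (1%:P)
| Hrel_ts : hrel (t * s) (s ^+ 2 * t)
| Hrel_ta i : hrel (t * a i) (- (a (- i)%R * t))
| Hrel_sa i : hrel (s * a i) (a (i + 1)%R * s)
| Hrel_aa i : hrel (a i ^+ 2) (mu%:P * (1%:P - t ^+ 2))
| Hrel_a01 : hrel (a 0%R * a 1%R + a 1%R * a 2%R + a 2%R * a 0%R)
                  (lam%:P * (1%:P - s * t ^+ 2))
| Hrel_a10 : hrel (a 1%R * a 0%R + a 2%R * a 1%R + a 0%R * a 2%R)
                  (lam%:P * (1%:P - s ^+ 2 * t ^+ 2)).

Definition haug (g : hgen) : k :=
  match g with Gs => 1 | Gt => 1 | Ga _ => 0 end.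

Lemma peval_pow (B : pzRingType) (phi : {rmorphism k -> B}) (f : hgen -> B) u n :
  peval phi f (u ^+ n)%P = peval phi f u ^+ n.
Proof.
by elim: n => [|n IHn] /=; rewrite ?rmorph1 // exprS -IHn.
Qed.

Lemma haugP u v : hrel u v -> peval (@id k) haug u = peval (@id k) haug v.
Proof.
have E n w : peval (@id k) haug (w ^+ n)%P = peval (@id k) haug w ^+ n.
  exact: (peval_pow idfun).
by case=> *; rewrite /= ?E /= ?(expr1n, mul1r, mulr1, mul0r, mulr0, addr0,
  mulN1r, oppr0, subrr).
Qed.

Definition hopf : presentation k := Presentation haugP.

Definition As : palg hopf := @pgen k hopf Gs.
Definition At : palg hopf := @pgen k hopf Gt.
Definition Aa (i : 'Z_3) : palg hopf := @pgen k hopf (Ga i).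

Lemma As3 : As ^+ 3 = 1.
Proof. by have := palg_rel (P := hopf) Hrel_s3; rewrite peval_pow /= scale1r. Qed.
Lemma At2l : At ^+ (2 * l) = 1.
Proof. by have := palg_rel (P := hopf) Hrel_t2l; rewrite peval_pow /= scale1r. Qed.
Lemma At_s : At * As = As ^+ 2 * At.
Proof. by have := palg_rel (P := hopf) Hrel_ts; rewrite /= scale1r mulr1. Qed.
Lemma At_a i : At * Aa i = - (Aa (- i) * At).
Proof.
by have := palg_rel (P := hopf) (Hrel_ta i); rewrite /= scaleN1r mulN1r.
Qed.
Lemma As_a i : As * Aa i = Aa (i + 1) * As.
Proof. exact: (palg_rel (P := hopf) (Hrel_sa i)). Qed.
Lemma Aa2 i : Aa i ^+ 2 = mu *: (1 - At ^+ 2).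
Proof.
have := palg_rel (P := hopf) (Hrel_aa i); rewrite /= !scale1r !mulr1 scaleN1r mulN1r.
by rewrite -scalerAl mul1r.
Qed.
Lemma Aa01 : Aa 0 * Aa 1 + Aa 1 * Aa 2 + Aa 2 * Aa 0 = lam *: (1 - As * At ^+ 2).
Proof.
have := palg_rel (P := hopf) Hrel_a01; rewrite /= !scale1r !mulr1 scaleN1r mulN1r.
by rewrite -scalerAl mul1r.
Qed.
Lemma Aa10 :
  Aa 1 * Aa 0 + Aa 2 * Aa 1 + Aa 0 * Aa 2 = lam *: (1 - As ^+ 2 * At ^+ 2).
Proof.
have := palg_rel (P := hopf) Hrel_a10; rewrite /= !scale1r !mulr1 scaleN1r mulN1r.
by rewrite -scalerAl mul1r.
Qed.

(* [s] has order 3, so [As ^+ (- i)%R] below is s^(-i). *)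
Definition Ag (i : 'Z_3) : palg hopf := As ^+ (- i)%R * At.

Lemma As_pow (n : nat) : As ^+ (n %% 3) = As ^+ n.
Proof. by rewrite [in RHS](divn_eq n 3) exprD mulnC exprM As3 expr1n mul1r. Qed.
Lemma As_powD (i j : 'Z_3) : As ^+ (i + j)%R = As ^+ i * As ^+ j.
Proof. by rewrite -exprD -[RHS]As_pow. Qed.
Lemma At_pow (i : 'Z_3) : At * As ^+ i = As ^+ (- i)%R * At.
Proof.
have E (n : nat) : At * As ^+ n = As ^+ (2 * n) * At.
  elim: n => [|n IHn]; first by rewrite mulr1 mul1r.
  by rewrite exprSr mulrA IHn -mulrA At_s mulrA -exprD mulnS addnC.
rewrite E -As_pow; congr (As ^+ _ * _).
by case: i => [[|[|[|]]]].
Qed.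
Lemma As_pow_a (i j : 'Z_3) : As ^+ i * Aa j = Aa (i + j) * As ^+ i.
Proof.
have E (n : nat) : As ^+ n * Aa j = Aa (n%:R + j) * As ^+ n.
  elim: n => [|n IHn]; first by rewrite mulr1 mul1r add0r.
  by rewrite exprS -mulrA IHn mulrA As_a -mulrA -exprS mulrSr addrAC.
by rewrite E natr_Zp.
Qed.

Lemma At_g i : At * Ag i = Ag (- i) * At.
Proof. by rewrite /Ag mulrA At_pow. Qed.
Lemma As_g i : As * Ag i = Ag (i + 1) * As.
Proof.
rewrite /Ag mulrA -exprS -[RHS]mulrA At_s [RHS]mulrA -exprD.
by congr (_ * _); rewrite -As_pow -[RHS]As_pow; case: i => [[|[|[|]]]].
Qed.
Lemma Agg i j : Ag i * Ag j = As ^+ (j - i)%R * At ^+ 2.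
Proof.
rewrite /Ag mulrA -[_ * At * _]mulrA At_pow opprK expr2 !mulrA.
by rewrite -As_powD addrC.
Qed.
Lemma Ag_a i j : Ag i * Aa j = - (Aa (- i - j) * Ag i).
Proof. by rewrite /Ag -mulrA At_a mulrN [in LHS]mulrA As_pow_a -mulrA. Qed.

Definition comult_gen (g : hgen) : palg (tens_pres hopf hopf) :=
  match g with
  | Gs => tens As As
  | Gt => tens At At
  | Ga i => tens (Aa i) 1 + tens (Ag i) (Aa i)
  end.

Lemma comult_aa i j : comult_gen (Ga i) * comult_gen (Ga j) =
  tens (Aa i * Aa j) 1 + tens (As ^+ (j - i)%R * At ^+ 2) (Aa i * Aa j)
  + (tens (Aa i * Ag j) (Aa j) - tens (Aa (- i - j) * Ag i) (Aa i)).
Proof.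
rewrite /= mulrDl !mulrDr !tensM !mulr1 !mul1r Agg Ag_a tensNl.
rewrite -!addrA; congr (_ + _); rewrite addrC -!addrA addrC -!addrA.
by congr (_ + _); rewrite addrC.
Qed.

Lemma comultP u v : hrel u v ->
  peval (in_alg _) comult_gen u = peval (in_alg _) comult_gen v.
Proof.
have quad c x (S : palg hopf) : x = c *: (1 - S) ->
    tens x 1 + tens S x = c *: (1 - tens S S).
  move=> ->; rewrite tensZl tensZr -scalerDr; congr (_ *: _).
  by rewrite tensDl tensDr tensNl tensNr tens11 addrA subrK.
have canc (V : zmodType) (p q r : V) : (p - q) + (q - r) + (r - p) = 0.
  by rewrite [p - q + _]addrA subrK addrA subrK subrr.
have canc' (V : zmodType) (p q r : V) : (p - r) + (q - p) + (r - q) = 0.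
  by rewrite [p - r + _]addrC canc.
have Z3 (i j : 'Z_3) : val i == val j -> i = j by move/eqP/val_inj.
have sumE (V : zmodType) (x y z x' y' z' p q r : V) :
    (x + x' + p) + (y + y' + q) + (z + z' + r) =
    x + y + z + (x' + y' + z') + (p + q + r).
  exact: (AC (3*3*3) ((1*4*7)*(2*5*8)*(3*6*9))).
case=> [|||i|i|i||].
- by rewrite peval_pow [LHS]tensX As3 tens11 /= scale1r.
- by rewrite peval_pow [LHS]tensX At2l tens11 /= scale1r.
- by rewrite /= scale1r mulr1 !tensM At_s.
- rewrite /= mulrDr scaleN1r mulN1r mulrDl !tensM At_a At_g mulr1 mul1r.
  by rewrite tensNl tensNr opprD.
- by rewrite /= mulrDr mulrDl !tensM As_a As_g mulr1 mul1r.
- rewrite /= !scale1r !mulr1 scaleN1r mulN1r !tensM -scalerAl mul1r.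
  rewrite [LHS]comult_aa subrr mul1r -!expr2.
  have -> : - i - i = i :> 'Z_3 by case: i => [[|[|[|]]]] // ?; apply: val_inj.
  by rewrite subrr addr0 (quad mu _ (At ^+ 2)) // Aa2.
- rewrite [LHS](_ : _ = comult_gen (Ga 0) * comult_gen (Ga 1)
     + comult_gen (Ga 1) * comult_gen (Ga 2)
     + comult_gen (Ga 2) * comult_gen (Ga 0)) //.
  rewrite !comult_aa sumE.
  rewrite (Z3 (1 - 0) 1) // (Z3 (2 - 1) 1) // (Z3 (0 - 2) 1) // expr1.
  rewrite (Z3 (- 0 - 1) 2) // (Z3 (- 1 - 2) 0) // (Z3 (- 2 - 0) 1) //.
  rewrite canc' addr0 -!tensDl -!tensDr (quad lam _ (As * At ^+ 2)) ?Aa01 //.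
  rewrite /= !scale1r !mulr1 scaleN1r mulN1r -!expr2 -scalerAl mul1r.
  by rewrite tensX tensM.
- rewrite [LHS](_ : _ = comult_gen (Ga 1) * comult_gen (Ga 0)
     + comult_gen (Ga 2) * comult_gen (Ga 1)
     + comult_gen (Ga 0) * comult_gen (Ga 2)) //.
  rewrite !comult_aa sumE.
  rewrite (Z3 (0 - 1) 2) // (Z3 (1 - 2) 2) // (Z3 (2 - 0) 2) //.
  rewrite (Z3 (- 1 - 0) 2) // (Z3 (- 2 - 1) 0) // (Z3 (- 0 - 2) 1) //.
  rewrite canc addr0 -!tensDl -!tensDr (quad lam _ (As ^+ 2 * At ^+ 2)) ?Aa10 //.
  rewrite /= !scale1r !mulr1 scaleN1r mulN1r -!expr2 -scalerAl mul1r.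
  by rewrite !tensX tensM.
Qed.

Definition comult : {lrmorphism palg hopf -> palg (tens_pres hopf hopf)} :=
  alg_lift (P := hopf) comultP.

Lemma comult_s : comult As = tens As As.
Proof. exact: (alg_lift_pgen (P := hopf) comultP Gs). Qed.
Lemma comult_t : comult At = tens At At.
Proof. exact: (alg_lift_pgen (P := hopf) comultP Gt). Qed.
Lemma comult_a i : comult (Aa i) = tens (Aa i) 1 + tens (Ag i) (Aa i).
Proof. exact: (alg_lift_pgen (P := hopf) comultP (Ga i)). Qed.

Definition tensor (m n : nat) (V : module hopf m) (W : module hopf n) :
  module hopf (m * n) := tens_module V W \o comult.

Lemma tensor_s m n (V : module hopf m) (W : module hopf n) :
  tensor V W As = V As *t W As.
Proof. by rewrite /tensor /= comult_s tens_moduleE. Qed.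
Lemma tensor_t m n (V : module hopf m) (W : module hopf n) :
  tensor V W At = V At *t W At.
Proof. by rewrite /tensor /= comult_t tens_moduleE. Qed.
Lemma tensor_a m n (V : module hopf m) (W : module hopf n) i :
  tensor V W (Aa i) = V (Aa i) *t 1%:M + V (Ag i) *t W (Aa i).
Proof. by rewrite /tensor /= comult_a rmorphD /= !tens_moduleE rmorph1. Qed.

End HopfAlgebra.

Record Lparam (k : fieldType) (p q r : nat) := LParam {
  L_alpha : 'M[k]_(q, p);
  L_beta : 'M[k]_(p, q);
  L_deltap : 'M[k]_(p, r);
  L_deltam : 'M[k]_(q, r);
  L_eta : 'M[k]_(r, p);
  L_sigma : 'M[k]_(r, q);
  L_theta : 'M[k]_(r, r);
  L_tau : 'M[k]_(r, r)
}.

(* Block matrices with the blocks listed row by row. *)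
Section Blocks.
Variable (R : Type).

Definition row3 m n1 n2 n3 (A1 : 'M[R]_(m, n1)) (A2 : 'M_(m, n2)) (A3 : 'M_(m, n3)) :
  'M_(m, n1 + n2 + n3) := row_mx (row_mx A1 A2) A3.
Definition row4 m n1 n2 n3 n4 (A1 : 'M[R]_(m, n1)) (A2 : 'M_(m, n2)) (A3 : 'M_(m, n3))
    (A4 : 'M_(m, n4)) : 'M_(m, n1 + n2 + n3 + n4) := row_mx (row3 A1 A2 A3) A4.
Definition row5 m n1 n2 n3 n4 n5 (A1 : 'M[R]_(m, n1)) (A2 : 'M_(m, n2)) (A3 : 'M_(m, n3))
    (A4 : 'M_(m, n4)) (A5 : 'M_(m, n5)) : 'M_(m, n1 + n2 + n3 + n4 + n5) :=
  row_mx (row4 A1 A2 A3 A4) A5.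
Definition col3 n m1 m2 m3 (A1 : 'M[R]_(m1, n)) (A2 : 'M_(m2, n)) (A3 : 'M_(m3, n)) :
  'M_(m1 + m2 + m3, n) := col_mx (col_mx A1 A2) A3.
Definition col4 n m1 m2 m3 m4 (A1 : 'M[R]_(m1, n)) (A2 : 'M_(m2, n)) (A3 : 'M_(m3, n))
    (A4 : 'M_(m4, n)) : 'M_(m1 + m2 + m3 + m4, n) := col_mx (col3 A1 A2 A3) A4.
Definition col5 n m1 m2 m3 m4 m5 (A1 : 'M[R]_(m1, n)) (A2 : 'M_(m2, n)) (A3 : 'M_(m3, n))
    (A4 : 'M_(m4, n)) (A5 : 'M_(m5, n)) : 'M_(m1 + m2 + m3 + m4 + m5, n) :=
  col_mx (col4 A1 A2 A3 A4) A5.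

End Blocks.

Section Lmodule.
Variables (k : fieldType) (l : nat) (lam mu xi zeta : k).

(* The action on the basis x, y, v, w in the form g . (x, y, v, w)^t =
   M (x, y, v, w)^t: row i of M gives the image of the i-th basis vector, so
   that g acts on columns of coordinates by M^T. *)
Definition L_s (p q r : nat) : 'M[k]_(p + q + r + r) :=
  col4 (row4 1%:M 0 0 0)
       (row4 0 1%:M 0 0)
       (row4 0 0 xi%:M 0)
       (row4 0 0 0 (xi ^+ 2)%:M).

Definition L_t (j : nat) (b : k) (p q r : nat) : 'M[k]_(p + q + r + r) :=
  col4 (row4 b%:M 0 0 0)
       (row4 0 (- b)%:M 0 0)
       (row4 0 0 0 1%:M)
       (row4 0 0 (zeta ^+ j)%:M 0).

Definition L_a0 (j : nat) (b : k) (p q r : nat) (m : Lparam k p q r) :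
    'M[k]_(p + q + r + r) :=
  col4 (row4 0 (L_beta m) (- b *: L_deltap m) (L_deltap m))
       (row4 (L_alpha m) 0 (b *: L_deltam m) (L_deltam m))
       (row4 (L_eta m) (L_sigma m) (L_theta m) (L_tau m))
       (row4 (- b *: L_eta m) (b *: L_sigma m) (- zeta ^+ j *: L_tau m) (- L_theta m)).

(* [V] is the module L_j^(p,q,r)(m) for the square root [b] of zeta^j.  As s, t
   and a_0 generate the algebra, there is at most one such [V]; there is one
   exactly when the matrices [m] define a module. *)
Definition is_L (j : nat) (b : k) (p q r : nat) (m : Lparam k p q r)
    (V : module (hopf l lam mu) (p + q + r + r)) : Prop :=
  [/\ (j < l)%N, b ^+ 2 = zeta ^+ j, V (As l lam mu) = (L_s p q r)^T,
      V (At l lam mu) = (L_t j b p q r)^T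
    & V (Aa l lam mu 0) = (L_a0 j b m)^T].

Lemma is_L_uniq j b p q r (m : Lparam k p q r) V V' :
  is_L j b m V -> is_L j b m V' -> V =1 V'.
Proof.
move=> [_ _ Vs Vt Va] [_ _ Vs' Vt' Va'].
have E0 := As3 l lam mu.
have aS i : Aa l lam mu (i + 1) = As l lam mu * Aa l lam mu i * As l lam mu ^+ 2.
  by rewrite As_a -mulrA -exprS E0 mulr1.
have VaS i : V (Aa l lam mu i) = V' (Aa l lam mu i) ->
    V (Aa l lam mu (i + 1)) = V' (Aa l lam mu (i + 1)).
  by move=> E; rewrite aS !rmorphM /= E Vs Vs'.
have V0 : V (Aa l lam mu 0) = V' (Aa l lam mu 0) by rewrite Va Va'.
move=> x; elim/(@palg_ind _ (hopf l lam mu)): x => [c|[||i]|x y|x y].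
- by rewrite !linearZ !rmorph1.
- by rewrite [LHS]Vs [RHS]Vs'.
- by rewrite [LHS]Vt [RHS]Vt'.
- have V1 := VaS _ V0; have V2 := VaS _ V1.
  have [] : [\/ i = 0, i = 0 + 1 | i = 0 + 1 + 1].
    case: i => [[|[|[|]]]] // ?.
    + by constructor 1; apply: val_inj.
    + by constructor 2; apply: val_inj.
    + by constructor 3; apply: val_inj.
  + by move->.
  + by move->.
  + by move->.
- by move=> Ex Ey; rewrite !rmorphD /= Ex Ey.
- by move=> Ex Ey; rewrite !rmorphM /= Ex Ey.
Qed.

End Lmodule.

Section TensorParameters.
Variables (k : fieldType) (bj bk : k).
Variables (p q r : nat) (m : Lparam k p q r).
Variables (p' q' r' : nat) (m' : Lparam k p' q' r').

Local Notation b := (bj * bk).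
(* M (x) id and id (x) M, the size of the identity being given by the block in
   which they occur. *)
Local Notation "M ⊗1" := (M *t 1%:M) (at level 2, format "M ⊗1").
Local Notation "1⊗ M" := (1%:M *t M) (at level 2, M at level 2, format "1⊗ M").

Local Notation α := (L_alpha m).
Local Notation β := (L_beta m).
Local Notation δp := (L_deltap m).
Local Notation δm := (L_deltam m).
Local Notation η := (L_eta m).
Local Notation σ := (L_sigma m).
Local Notation θ := (L_theta m).
Local Notation τ := (L_tau m).
Local Notation α' := (L_alpha m').
Local Notation β' := (L_beta m').
Local Notation δp' := (L_deltap m').
Local Notation δm' := (L_deltam m').
Local Notation η' := (L_eta m').
Local Notation σ' := (L_sigma m').
Local Notation θ' := (L_theta m').
Local Notation τ' := (L_tau m').

(* In terms of the bases x, y, v, w and x', y', v', w' of the two factors, the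
   blocks below correspond in this order to
     pt : x(x)x', y(x)y', bj v(x)w' + bk w(x)v';
     qt : x(x)y', y(x)x', bj v(x)w' - bk w(x)v';
     rt : x(x)v', y(x)v', v(x)x', v(x)y', w(x)w' for the eigenvalue xi of s, and
          bj x(x)w', -bj y(x)w', bk w(x)x', -bk w(x)y', b^2 v(x)v' for xi^2. *)
Definition pt : nat := p * p' + q * q' + r * r'.
Definition qt : nat := p * q' + q * p' + r * r'.
Definition rt : nat := p * r' + q * r' + r * p' + r * q' + r * r'.

Definition alpha_t : 'M[k]_(qt, pt) :=
  col3 (row3 (bj *: 1⊗α') β⊗1 0)
       (row3 α⊗1 (- bj *: 1⊗β') 0)
       (row3 0 0 (θ⊗1 - b *: 1⊗τ')).

Definition beta_t : 'M[k]_(pt, qt) :=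
  col3 (row3 (bj *: 1⊗β') β⊗1 0)
       (row3 α⊗1 (- bj *: 1⊗α') 0)
       (row3 0 0 (θ⊗1 + b *: 1⊗τ')).

Definition deltap_t : 'M[k]_(pt, rt) :=
  col3 (row5 1⊗δp' 0 (bk^-1 *: δp⊗1) 0 0)
       (row5 0 1⊗δm' 0 (- bk^-1 *: δm⊗1) 0)
       (row5 η⊗1 (- σ⊗1) (- bj *: 1⊗η') (- bj *: 1⊗σ')
             (- bk^-1 *: (τ⊗1 - 1⊗θ'))).

Definition deltam_t : 'M[k]_(qt, rt) :=
  col3 (row5 1⊗δm' 0 0 (- bk^-1 *: δp⊗1) 0)
       (row5 0 1⊗δp' (bk^-1 *: δm⊗1) 0 0)
       (row5 η⊗1 (- σ⊗1) (- bj *: 1⊗η') (- bj *: 1⊗σ')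
             (bk^-1 *: (τ⊗1 - 1⊗θ'))).

Definition eta_t : 'M[k]_(rt, pt) :=
  col5 (row3 (bj *: 1⊗η') 0 ((bk^-1 / 2) *: δp⊗1))
       (row3 0 (- bj *: 1⊗σ') ((bk^-1 / 2) *: δm⊗1))
       (row3 η⊗1 0 (- (1 / 2) *: 1⊗δp'))
       (row3 0 σ⊗1 ((1 / 2) *: 1⊗δm'))
       (row3 0 0 (- (bj / 2) *: (τ⊗1 + 1⊗θ'))).

Definition sigma_t : 'M[k]_(rt, qt) :=
  col5 (row3 (bj *: 1⊗σ') 0 (- (bk^-1 / 2) *: δp⊗1))
       (row3 0 (- bj *: 1⊗η') (- (bk^-1 / 2) *: δm⊗1))
       (row3 0 σ⊗1 ((1 / 2) *: 1⊗δp'))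
       (row3 η⊗1 0 (- (1 / 2) *: 1⊗δm'))
       (row3 0 0 (- (bj / 2) *: (τ⊗1 + 1⊗θ'))).

Definition theta_t : 'M[k]_(rt, rt) :=
  col5 (row5 (bj *: 1⊗θ') β⊗1 0 0 0)
       (row5 α⊗1 (- bj *: 1⊗θ') 0 0 0)
       (row5 0 0 θ⊗1 0 1⊗δp')
       (row5 0 0 0 θ⊗1 1⊗δm')
       (row5 0 0 (- (bj * b) *: 1⊗η') ((bj * b) *: 1⊗σ') (- θ⊗1)).

Definition tau_t : 'M[k]_(rt, rt) :=
  col5 (row5 1⊗τ' 0 0 0 (- (bk^-1 * b^-1) *: δp⊗1))
       (row5 0 1⊗τ' 0 0 ((bk^-1 * b^-1) *: δm⊗1))
       (row5 0 0 (bk^-1 *: τ⊗1) (- bk^-1 *: 1⊗β') 0)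
       (row5 0 0 (bk^-1 *: 1⊗α') (- bk^-1 *: τ⊗1) 0)
       (row5 (- η⊗1) (- σ⊗1) 0 0 (- 1⊗τ')).

Definition Lparam_t : Lparam k pt qt rt :=
  LParam alpha_t beta_t deltap_t deltam_t eta_t sigma_t theta_t tau_t.

End TensorParameters.

(* Main.v *)
From HB Require Import structures.
Require Import Defs.
From mathcomp Require Import all_boot all_order all_algebra.
From mathcomp Require Import mxtens ring.

(** The tensor product of two modules in the family L is put into the normal
form of that family by a single change of basis, and all the parameter
matrices can be read off once this basis is known.

Since s acts on the basis vectors x, y, v, w by 1, 1, xi, xi^2, the
eigenspaces of s on a tensor product are spanned as follows: 1 by the products
of an x or y with an x' or y' and by v (x) w', w (x) v'; xi by the products
of an x or y with v', of v with an x' or y', and by w (x) w'; and xi^2 by the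
images under t of the previous ones.  The eigenvalues +-b of t, where
b = bj * bk, split the first eigenspace, the two mixed products contributing
bj v (x) w' + bk w (x) v' and bj v (x) w' - bk w (x) v'.  This is the family
[tens_family] below.  It is a basis because dividing by 2, bj and bk expresses
the products of basis vectors through it: the matrix of these expressions,
[tens_cofamily], is a one-sided inverse of the square matrix of the family.

Actions are handled on families of row vectors: a family X, Y, V, W stacked as
[col4 X Y V W] behaves like x, y, v, w under an endomorphism M when
[col4 X Y V W *m M = L *m col4 X Y V W] for L the matrix [L_s], [L_t] or
[L_a0].  The lemmas [L_s_rows], [L_t_rows] and [L_a0_rows] turn this into
the formulas for the action on x, y, v, w.  The generators act on the tensor
product through s (x) s, t (x) t and a_0 (x) 1 + t (x) a_0, so
[tens_family_s], [tens_family_t] and [tens_family_a0] reduce, block by block,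
to linear identities between Kronecker products.

The module L of the theorem is the tensor product transported along the
change of basis. *)

Set Implicit Arguments.
Unset Strict Implicit.
Unset Printing Implicit Defensive.

Import GRing.Theory.
Local Open Scope ring_scope.

(** * Block matrices *)

Section BlockMatrices.
Variable k : fieldType.

Lemma mul_col3 m1 m2 m3 n s (A1 : 'M[k]_(m1, n)) (A2 : 'M_(m2, n))
    (A3 : 'M_(m3, n)) (B : 'M_(n, s)) :
  col3 A1 A2 A3 *m B = col3 (A1 *m B) (A2 *m B) (A3 *m B).
Proof. by rewrite /col3 !mul_col_mx. Qed.

Lemma mul_col4 m1 m2 m3 m4 n s (A1 : 'M[k]_(m1, n)) (A2 : 'M_(m2, n))
    (A3 : 'M_(m3, n)) (A4 : 'M_(m4, n)) (B : 'M_(n, s)) :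
  col4 A1 A2 A3 A4 *m B = col4 (A1 *m B) (A2 *m B) (A3 *m B) (A4 *m B).
Proof. by rewrite /col4 mul_col_mx mul_col3. Qed.

Lemma mul_col5 m1 m2 m3 m4 m5 n s (A1 : 'M[k]_(m1, n)) (A2 : 'M_(m2, n))
    (A3 : 'M_(m3, n)) (A4 : 'M_(m4, n)) (A5 : 'M_(m5, n)) (B : 'M_(n, s)) :
  col5 A1 A2 A3 A4 A5 *m B =
  col5 (A1 *m B) (A2 *m B) (A3 *m B) (A4 *m B) (A5 *m B).
Proof. by rewrite /col5 mul_col_mx mul_col4. Qed.

Lemma mul_row3_col3 m n1 n2 n3 s (A1 : 'M[k]_(m, n1)) (A2 : 'M_(m, n2))
    (A3 : 'M_(m, n3)) (B1 : 'M_(n1, s)) (B2 : 'M_(n2, s)) (B3 : 'M_(n3, s)) :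
  row3 A1 A2 A3 *m col3 B1 B2 B3 = A1 *m B1 + A2 *m B2 + A3 *m B3.
Proof. by rewrite /row3 /col3 !mul_row_col. Qed.

Lemma mul_row4_col4 m n1 n2 n3 n4 s (A1 : 'M[k]_(m, n1)) (A2 : 'M_(m, n2))
    (A3 : 'M_(m, n3)) (A4 : 'M_(m, n4)) (B1 : 'M_(n1, s)) (B2 : 'M_(n2, s))
    (B3 : 'M_(n3, s)) (B4 : 'M_(n4, s)) :
  row4 A1 A2 A3 A4 *m col4 B1 B2 B3 B4 =
  A1 *m B1 + A2 *m B2 + A3 *m B3 + A4 *m B4.
Proof. by rewrite /row4 /col4 mul_row_col mul_row3_col3. Qed.

Lemma mul_row5_col5 m n1 n2 n3 n4 n5 s (A1 : 'M[k]_(m, n1)) (A2 : 'M_(m, n2))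
    (A3 : 'M_(m, n3)) (A4 : 'M_(m, n4)) (A5 : 'M_(m, n5)) (B1 : 'M_(n1, s))
    (B2 : 'M_(n2, s)) (B3 : 'M_(n3, s)) (B4 : 'M_(n4, s)) (B5 : 'M_(n5, s)) :
  row5 A1 A2 A3 A4 A5 *m col5 B1 B2 B3 B4 B5 =
  A1 *m B1 + A2 *m B2 + A3 *m B3 + A4 *m B4 + A5 *m B5.
Proof. by rewrite /row5 /col5 mul_row_col mul_row4_col4. Qed.

Lemma add_col3 m1 m2 m3 n (A1 B1 : 'M[k]_(m1, n)) (A2 B2 : 'M_(m2, n))
    (A3 B3 : 'M_(m3, n)) :
  col3 A1 A2 A3 + col3 B1 B2 B3 = col3 (A1 + B1) (A2 + B2) (A3 + B3).
Proof. by rewrite /col3 !add_col_mx. Qed.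

Lemma add_col5 m1 m2 m3 m4 m5 n (A1 B1 : 'M[k]_(m1, n)) (A2 B2 : 'M_(m2, n))
    (A3 B3 : 'M_(m3, n)) (A4 B4 : 'M_(m4, n)) (A5 B5 : 'M_(m5, n)) :
  col5 A1 A2 A3 A4 A5 + col5 B1 B2 B3 B4 B5 =
  col5 (A1 + B1) (A2 + B2) (A3 + B3) (A4 + B4) (A5 + B5).
Proof. by rewrite /col5 /col4 /col3 !add_col_mx. Qed.

Lemma scale_col3 m1 m2 m3 n c (A1 : 'M[k]_(m1, n)) (A2 : 'M_(m2, n))
    (A3 : 'M_(m3, n)) :
  c *: col3 A1 A2 A3 = col3 (c *: A1) (c *: A2) (c *: A3).
Proof. by rewrite /col3 !scale_col_mx. Qed.

Lemma scale_col5 m1 m2 m3 m4 m5 n c (A1 : 'M[k]_(m1, n)) (A2 : 'M_(m2, n))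
    (A3 : 'M_(m3, n)) (A4 : 'M_(m4, n)) (A5 : 'M_(m5, n)) :
  c *: col5 A1 A2 A3 A4 A5 =
  col5 (c *: A1) (c *: A2) (c *: A3) (c *: A4) (c *: A5).
Proof. by rewrite /col5 /col4 /col3 !scale_col_mx. Qed.

Lemma opp_col5 m1 m2 m3 m4 m5 n (A1 : 'M[k]_(m1, n)) (A2 : 'M_(m2, n))
    (A3 : 'M_(m3, n)) (A4 : 'M_(m4, n)) (A5 : 'M_(m5, n)) :
  - col5 A1 A2 A3 A4 A5 = col5 (- A1) (- A2) (- A3) (- A4) (- A5).
Proof. by rewrite /col5 /col4 /col3 !opp_col_mx. Qed.

Lemma eq_col4 m1 m2 m3 m4 n (A1 B1 : 'M[k]_(m1, n)) (A2 B2 : 'M_(m2, n))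
    (A3 B3 : 'M_(m3, n)) (A4 B4 : 'M_(m4, n)) :
  col4 A1 A2 A3 A4 = col4 B1 B2 B3 B4 -> [/\ A1 = B1, A2 = B2, A3 = B3 & A4 = B4].
Proof. by rewrite /col4 /col3 => /eq_col_mx[/eq_col_mx[/eq_col_mx[-> ->] ->] ->]. Qed.

Lemma congr_col3 m1 m2 m3 n (A1 B1 : 'M[k]_(m1, n)) (A2 B2 : 'M_(m2, n))
    (A3 B3 : 'M_(m3, n)) :
  A1 = B1 -> A2 = B2 -> A3 = B3 -> col3 A1 A2 A3 = col3 B1 B2 B3.
Proof. by move=> -> -> ->. Qed.

Lemma congr_col5 m1 m2 m3 m4 m5 n (A1 B1 : 'M[k]_(m1, n)) (A2 B2 : 'M_(m2, n))
    (A3 B3 : 'M_(m3, n)) (A4 B4 : 'M_(m4, n)) (A5 B5 : 'M_(m5, n)) :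
  A1 = B1 -> A2 = B2 -> A3 = B3 -> A4 = B4 -> A5 = B5 ->
  col5 A1 A2 A3 A4 A5 = col5 B1 B2 B3 B4 B5.
Proof. by move=> -> -> -> -> ->. Qed.

(** The coordinate rows of the four blocks are dual to the coordinate columns,
which are their transposes. *)
Lemma std_family_exists (p q r : nat) :
  exists (X : 'M[k]_(p, p + q + r + r)) (Y : 'M[k]_(q, p + q + r + r))
    (V W : 'M[k]_(r, p + q + r + r)),
    col4 X Y V W = 1%:M /\ row4 X^T Y^T V^T W^T = 1%:M.
Proof.
have E : col4 (row4 1%:M 0 0 0) (row4 0 1%:M 0 0) (row4 0 0 1%:M 0)
    (row4 0 0 0 1%:M) = 1%:M :> 'M[k]_(p + q + r + r).
  have split_col m n s (A : 'M[k]_(m, s)) (B : 'M_(n, s)) d :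
      row_mx (col_mx A B) (0 : 'M_(m + n, d)) = col_mx (row_mx A 0) (row_mx B 0).
    by rewrite -(col_mx0 k m n d) -block_mxEh block_mxEv.
  by rewrite /col4 /col3 /row4 /row3 !scalar_mx_block !block_mxEv !split_col !row_mx0.
exists (row4 1%:M 0 0 0), (row4 0 1%:M 0 0), (row4 0 0 1%:M 0), (row4 0 0 0 1%:M).
by split=> //; rewrite -[RHS]trmx1 -E /row4 /row3 /col4 /col3 !tr_col_mx.
Qed.

Lemma mulmx1_eqdim m n (A : 'M[k]_(m, n)) (B : 'M_(n, m)) :
  m = n -> A *m B = 1%:M -> B *m A = 1%:M.
Proof. by move=> E; case: _ / E A B => A B; apply: mulmx1C. Qed.

End BlockMatrices.

(** * Linear identities between Kronecker products *)

Section KroneckerBilinear.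
Variable k : fieldType.

Section Bilinear.
Variables (m n m' n' : nat).
Implicit Types (A : 'M[k]_(m, n)) (B : 'M[k]_(m', n')).

Lemma tensmxDl A A' B : (A + A') *t B = A *t B + A' *t B.
Proof. by apply/matrixP=> i j; rewrite !mxE mulrDl. Qed.
Lemma tensmxDr A B B' : A *t (B + B') = A *t B + A *t B'.
Proof. by apply/matrixP=> i j; rewrite !mxE mulrDr. Qed.
Lemma tensmxZl c A B : (c *: A) *t B = c *: (A *t B).
Proof. by apply/matrixP=> i j; rewrite !mxE mulrA. Qed.
Lemma tensmxZr c A B : A *t (c *: B) = c *: (A *t B).
Proof. by apply/matrixP=> i j; rewrite !mxE mulrCA. Qed.
Lemma tensmxNl A B : (- A) *t B = - (A *t B).
Proof. by rewrite -scaleN1r tensmxZl scaleN1r. Qed.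
Lemma tensmxNr A B : A *t (- B) = - (A *t B).
Proof. by rewrite -scaleN1r tensmxZr scaleN1r. Qed.
End Bilinear.

(** [tensmx_mul] over a field.  Elaborated there, both sides mention the same
ring structure, so that the products it creates are syntactically equal to
those of the statements below. *)
Lemma mulmx_tens m n s m' n' s' (A : 'M[k]_(m, n)) (B : 'M_(m', n'))
    (C : 'M_(n, s)) (D : 'M_(n', s')) :
  (A *t B) *m (C *t D) = (A *m C) *t (B *m D).
Proof. exact: tensmx_mul. Qed.

Lemma mulmxZl m n s c (A : 'M[k]_(m, n)) (B : 'M_(n, s)) :
  (c *: A) *m B = c *: (A *m B).
Proof. by rewrite scalemxAl. Qed.

Lemma mulmxZr m n s c (A : 'M[k]_(m, n)) (B : 'M_(n, s)) :
  A *m (c *: B) = c *: (A *m B).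
Proof. by rewrite scalemxAr. Qed.

End KroneckerBilinear.

Definition mulmx_lin :=
  (mulmxDl, mulmxDr, mulmxN, mulNmx, mulmxZl, mulmxZr, mulmx_tens).
Definition tensmx_lin :=
  (tensmxDl, tensmxDr, tensmxNl, tensmxNr, tensmxZl, tensmxZr).

(* Entrywise, a linear identity between Kronecker products is an identity of
   scalars.  The Kronecker product is abstracted first, so that its values are
   atoms and are not unfolded. *)
Ltac kronecker_entries :=
  match goal with |- context [@tensmx ?R] => generalize (@tensmx R) => tens end;
  apply/matrixP => i1 i2; rewrite ?mxE.

Ltac expand_kronecker eqs :=
  rewrite ?mulmx_lin ?eqs ?mulmx1 ?mul1mx ?tensmx_lin; kronecker_entries.

(** * Families on which the generators act as on x, y, v, w *)

Section Rows.
Variables (k : fieldType) (xi zeta b : k) (j p q r N : nat).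
Variables (X : 'M[k]_(p, N)) (Y : 'M[k]_(q, N)) (V W : 'M[k]_(r, N)).
Local Notation B := (col4 X Y V W).

Lemma L_s_rows (S : 'M[k]_N) : B *m S = L_s xi p q r *m B <->
  [/\ X *m S = X, Y *m S = Y, V *m S = xi *: V & W *m S = xi ^+ 2 *: W].
Proof.
rewrite /L_s !mul_col4 !mul_row4_col4 !mul0mx !mul1mx !mul_scalar_mx ?addr0 ?add0r.
by split=> [/eq_col4 //|[-> -> -> ->]].
Qed.

Lemma L_t_rows (T : 'M[k]_N) : B *m T = L_t zeta j b p q r *m B <->
  [/\ X *m T = b *: X, Y *m T = - b *: Y, V *m T = W & W *m T = zeta ^+ j *: V].
Proof.
rewrite /L_t !mul_col4 !mul_row4_col4 !mul0mx !mul1mx !mul_scalar_mx ?addr0 ?add0r.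
by split=> [/eq_col4 //|[-> -> -> ->]].
Qed.

Lemma L_a0_rows (m : Lparam k p q r) (A : 'M[k]_N) :
  B *m A = L_a0 zeta j b m *m B <->
  [/\ X *m A = L_beta m *m Y - b *: (L_deltap m *m V) + L_deltap m *m W,
      Y *m A = L_alpha m *m X + b *: (L_deltam m *m V) + L_deltam m *m W,
      V *m A = L_eta m *m X + L_sigma m *m Y + L_theta m *m V + L_tau m *m W
    & W *m A = - b *: (L_eta m *m X) + b *: (L_sigma m *m Y)
               - zeta ^+ j *: (L_tau m *m V) - L_theta m *m W].
Proof.
rewrite /L_a0 !mul_col4 !mul_row4_col4 !mul0mx ?addr0 ?add0r -!scalemxAl !mulNmx.
rewrite !scaleNr.
by split=> [/eq_col4 //|[-> -> -> ->]].
Qed.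
End Rows.

(** * The basis of the tensor product *)

Section TensorFamily.
Variables (k : fieldType) (bj bk : k).
Variables (p q r N : nat) (X : 'M[k]_(p, N)) (Y : 'M[k]_(q, N))
  (V W : 'M[k]_(r, N)).
Variables (p' q' r' N' : nat) (X' : 'M[k]_(p', N')) (Y' : 'M[k]_(q', N'))
  (V' W' : 'M[k]_(r', N')).

(** The scalars in the last block, made of the eigenvectors of s for xi^2, are
those that make it the image of the block before it under t (x) t. *)
Definition tens_family :
    'M[k]_(pt p q r p' q' r' + qt p q r p' q' r' + rt p q r p' q' r'
           + rt p q r p' q' r', N * N') :=
  col4
    (col3 (X *t X') (Y *t Y') (bj *: (V *t W') + bk *: (W *t V')))
    (col3 (X *t Y') (Y *t X') (bj *: (V *t W') - bk *: (W *t V')))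
    (col5 (X *t V') (Y *t V') (V *t X') (V *t Y') (W *t W'))
    (col5 (bj *: (X *t W')) (- bj *: (Y *t W')) (bk *: (W *t X'))
          (- bk *: (W *t Y')) ((bj * bk) ^+ 2 *: (V *t V'))).

End TensorFamily.

Section TensorBasis.
Variables (k : fieldType) (bj bk : k).
Hypotheses (bj0 : bj != 0) (bk0 : bk != 0) (two0 : 2 != 0 :> k).
Variables (p q r N : nat) (X : 'M[k]_(p, N)) (Y : 'M[k]_(q, N))
  (V W : 'M[k]_(r, N)).
Variables (cX : 'M[k]_(N, p)) (cY : 'M[k]_(N, q)) (cV cW : 'M[k]_(N, r)).
Variables (p' q' r' N' : nat) (X' : 'M[k]_(p', N')) (Y' : 'M[k]_(q', N'))
  (V' W' : 'M[k]_(r', N')).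
Variables (cX' : 'M[k]_(N', p')) (cY' : 'M[k]_(N', q')) (cV' cW' : 'M[k]_(N', r')).

(** The dual basis of [tens_family] when cX, cY, cV, cW and cX', cY', cV', cW'
are dual to X, Y, V, W and X', Y', V', W'.  The halves come from solving
bj v (x) w' +- bk w (x) v' for v (x) w' and w (x) v'. *)
Definition tens_cofamily :
    'M[k]_(N * N', pt p q r p' q' r' + qt p q r p' q' r' + rt p q r p' q' r'
           + rt p q r p' q' r') :=
  row4
    (row3 (cX *t cX') (cY *t cY')
          ((2 * bj)^-1 *: (cV *t cW') + (2 * bk)^-1 *: (cW *t cV')))
    (row3 (cX *t cY') (cY *t cX')
          ((2 * bj)^-1 *: (cV *t cW') - (2 * bk)^-1 *: (cW *t cV')))
    (row5 (cX *t cV') (cY *t cV') (cV *t cX') (cV *t cY') (cW *t cW'))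
    (row5 (bj^-1 *: (cX *t cW')) (- bj^-1 *: (cY *t cW')) (bk^-1 *: (cW *t cX'))
          (- bk^-1 *: (cW *t cY')) ((bj * bk) ^- 2 *: (cV *t cV'))).

(** The sum of the rank-one pieces of the new basis regroups into
(cX X + cY Y + cV V + cW W) (x) (cX' X' + cY' Y' + cV' V' + cW' W').  The
opposite product would require checking all pairs of blocks; it follows from
this one by equality of dimensions. *)
Lemma tens_cofamilyP :
  row4 cX cY cV cW *m col4 X Y V W = 1%:M ->
  row4 cX' cY' cV' cW' *m col4 X' Y' V' W' = 1%:M ->
  tens_cofamily *m tens_family bj bk X Y V W X' Y' V' W' = 1%:M.
Proof.
move=> E E'; rewrite !mul_row4_col4 in E E'; rewrite -tensmx11 -E -E'.
rewrite /tens_cofamily /tens_family mul_row4_col4 !mul_row5_col5 !mul_row3_col3.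
rewrite ?tensmx_lin ?mulmx_lin ?tensmx_lin.
by kronecker_entries; field; rewrite ?bj0 ?bk0 ?two0.
Qed.
End TensorBasis.

Lemma tens_dim p q r p' q' r' :
  (pt p q r p' q' r' + qt p q r p' q' r' + rt p q r p' q' r' + rt p q r p' q' r'
   = (p + q + r + r) * (p' + q' + r' + r'))%N.
Proof. by rewrite /pt /qt /rt; ring. Qed.

(** * The action of the generators on this basis *)

Section TensorAction.
Variables (k : fieldType) (bj bk xi zeta : k) (j h i : nat).
Hypotheses (bjE : bj ^+ 2 = zeta ^+ j) (bkE : bk ^+ 2 = zeta ^+ h)
  (bE : (bj * bk) ^+ 2 = zeta ^+ i).
Variables (p q r N : nat) (X : 'M[k]_(p, N)) (Y : 'M[k]_(q, N))
  (V W : 'M[k]_(r, N)).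
Variables (p' q' r' N' : nat) (X' : 'M[k]_(p', N')) (Y' : 'M[k]_(q', N'))
  (V' W' : 'M[k]_(r', N')).
Local Notation B := (col4 X Y V W).
Local Notation B' := (col4 X' Y' V' W').
Local Notation BB := (tens_family bj bk X Y V W X' Y' V' W').
Variables (S T A : 'M[k]_N) (S' T' A' : 'M[k]_N').
Variables (m : Lparam k p q r) (m' : Lparam k p' q' r').

(** The eigenvalues of s (x) s on v (x) w', v (x) v' and w (x) w' are
xi * xi^2 = 1, xi * xi = xi^2 and xi^2 * xi^2 = xi. *)
Lemma tens_family_s : xi ^+ 3 = 1 ->
  B *m S = L_s xi p q r *m B -> B' *m S' = L_s xi p' q' r' *m B' ->
  BB *m (S *t S') = L_s xi _ _ _ *m BB.
Proof.
move=> xi3 /L_s_rows[SX SY SV SW] /L_s_rows[SX' SY' SV' SW'].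
apply/L_s_rows; split; rewrite ?scale_col5 ?mul_col5 ?mul_col3;
  (apply: congr_col5 || apply: congr_col3).
all: expand_kronecker (SX, SY, SV, SW, SX', SY', SV', SW').
all: ring: xi3.
Qed.

Lemma tens_family_t : B *m T = L_t zeta j bj p q r *m B ->
  B' *m T' = L_t zeta h bk p' q' r' *m B' ->
  BB *m (T *t T') = L_t zeta i (bj * bk) _ _ _ *m BB.
Proof.
move=> /L_t_rows[TX TY TV TW] /L_t_rows[TX' TY' TV' TW'].
rewrite -bjE in TW; rewrite -bkE in TW'; apply/L_t_rows; rewrite -bE.
split; rewrite ?scale_col5 ?scale_col3 ?mul_col5 ?mul_col3;
  (apply: congr_col5 || apply: congr_col3).
all: expand_kronecker (TX, TY, TV, TW, TX', TY', TV', TW').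
all: ring.
Qed.

(** On both sides every block is a combination of Kronecker products of one of
X, Y, V, W or of a parameter matrix applied to it with the same for the primed
family; the scalars bk^-1 and 1 / 2 in the parameters of the tensor product
undo those in the definition of the family. *)
Lemma tens_family_a0 : bj != 0 -> bk != 0 -> 2 != 0 :> k ->
  B *m T = L_t zeta j bj p q r *m B ->
  B *m A = L_a0 zeta j bj m *m B ->
  B' *m A' = L_a0 zeta h bk m' *m B' ->
  BB *m (A *t 1%:M + T *t A') =
  L_a0 zeta i (bj * bk) (Lparam_t bj bk m m') *m BB.
Proof.
move=> bj0 bk0 two0.
move=> /L_t_rows[TX TY TV TW] /L_a0_rows[AX AY AV AW] /L_a0_rows[AX' AY' AV' AW'].
rewrite -bjE in TW AW; rewrite -bkE in AW'; apply/L_a0_rows; rewrite -bE.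
split=> /=; rewrite /alpha_t /beta_t /deltap_t /deltam_t /eta_t /sigma_t
  /theta_t /tau_t.
(* The rules for three blocks also match five blocks, read as three of which
   the first is itself a block matrix; so the rules for five come first. *)
all: rewrite ?mul_col5 ?mul_col3 ?mul_row5_col5 ?mul_row3_col3.
all: rewrite -?scaleNr ?scale_col5 ?scale_col3 ?opp_col5 ?add_col5 ?add_col3;
  (apply: congr_col5 || apply: congr_col3).
all: rewrite ?mul0mx ?addr0 ?add0r.
all: expand_kronecker (TX, TY, TV, TW, AX, AY, AV, AW, AX', AY', AV', AW').
all: field; by rewrite ?bj0 ?bk0 ?two0.
Qed.

End TensorAction.

(** * Transport of a module along a change of basis *)

Section Conjugation.
Variables (k : fieldType) (P : presentation k) (m n : nat) (V : module P m).
Variables (f : 'M[k]_(n, m)) (g : 'M[k]_(m, n)).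
Hypotheses (gf : g *m f = 1%:M) (fg : f *m g = 1%:M).

Definition conj_fun (x : palg P) : 'M[k]_n := f *m V x *m g.

Fact conj_nmod : nmod_morphism conj_fun.
Proof.
by split=> [|x y]; rewrite /conj_fun ?raddf0 ?mulmx0 ?mul0mx // raddfD mulmxDr mulmxDl.
Qed.

Fact conj_monoid : monoid_morphism conj_fun.
Proof.
split=> [|x y]; rewrite /conj_fun; first by rewrite rmorph1 mulmx1.
rewrite rmorphM /= -[RHS]/(f *m V x *m g *m (f *m V y *m g)).
by rewrite !mulmxA -[_ *m g *m f]mulmxA gf mulmx1.
Qed.

Fact conj_scalable : scalable conj_fun.
Proof. by move=> c x; rewrite /conj_fun linearZ /= -scalemxAr -scalemxAl. Qed.

HB.instance Definition _ := GRing.isNmodMorphism.Build (palg P) 'M[k]_n conj_fun conj_nmod.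
HB.instance Definition _ := GRing.isMonoidMorphism.Build (palg P) 'M[k]_n conj_fun conj_monoid.
HB.instance Definition _ := GRing.isScalable.Build k (palg P) 'M[k]_n *:%R conj_fun conj_scalable.

Definition conj_module : module P n := conj_fun.

Lemma conj_module_iso : module_iso V conj_module.
Proof.
exists f, g; split=> // x.
by rewrite -[conj_module x]/(f *m V x *m g) -[RHS]mulmxA gf mulmx1.
Qed.

(** Matrices of the form [L_s], [L_t], [L_a0] act on columns by their
transposes, so for them the change of basis acts on rows. *)
Lemma conj_module_tr x (M : 'M_m) (M' : 'M_n) :
  V x = M^T -> g^T *m M = M' *m g^T -> conj_module x = M'^T.
Proof.
move=> Vx E; rewrite -[conj_module x]/(f *m V x *m g) Vx -mulmxA.
by rewrite -[X in _ *m (_ *m X)]trmxK -trmx_mul E trmx_mul trmxK mulmxA fg mul1mx.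
Qed.
End Conjugation.

(** * The parameters of the tensor product *)

Theorem proposition3p32 (k : closedFieldType) (char0 : [pchar k] =i pred0)
  (l : nat) (l_gt1 : (1 < l)%N) (lam mu xi zeta : k)
  (xi_prim : 3.-primitive_root xi) (zeta_prim : l.-primitive_root zeta)
  (bs : nat -> k) (bs0 : bs 0%N = 1)
  (bs_sq : forall i : nat, (i < l)%N -> bs i ^+ 2 = zeta ^+ i)
  (j h : nat) (j_lt : (j < l)%N) (h_lt : (h < l)%N)
  (p q r p' q' r' : nat)
  (m : Lparam k p q r) (m' : Lparam k p' q' r')
  (Lj : module (hopf l lam mu) (p + q + r + r))
  (Lh : module (hopf l lam mu) (p' + q' + r' + r'))
  (HLj : is_L xi zeta j (bs j) m Lj) (HLh : is_L xi zeta h (bs h) m' Lh) :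
  exists L : module (hopf l lam mu)
      (pt p q r p' q' r' + qt p q r p' q' r' + rt p q r p' q' r' + rt p q r p' q' r'),
    is_L xi zeta ((j + h) %% l)%N (bs j * bs h) (Lparam_t (bs j) (bs h) m m') L
    /\ module_iso (tensor Lj Lh) L.
Proof.
have [[_ bjE Ls Lt La] [_ bhE Ls' Lt' La']] := (HLj, HLh).
have zeta0 : zeta != 0.
  apply/eqP=> z0; have /eqP := prim_expr_order zeta_prim.
  by rewrite z0 expr0n (gtn_eqF (ltnW l_gt1)) eq_sym oner_eq0.
have nz i : (i < l)%N -> bs i != 0.
  by move=> /bs_sq E; rewrite -sqrf_eq0 E expf_neq0.
have two0 : 2 != 0 :> k by move/pcharf0P: char0 => ->.
have bE : (bs j * bs h) ^+ 2 = zeta ^+ ((j + h) %% l).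
  by rewrite exprMn bjE bhE -exprD (prim_expr_mod zeta_prim).
have [eX [eY [eV [eW [B1 C1]]]]] := std_family_exists k p q r.
have [eX' [eY' [eV' [eW' [B1' C1']]]]] := std_family_exists k p' q' r'.
(* On standard bases every action is given by its own matrix. *)
have [std std'] : (forall M, col4 eX eY eV eW *m M = M *m col4 eX eY eV eW) /\
    (forall M, col4 eX' eY' eV' eW' *m M = M *m col4 eX' eY' eV' eW').
  by split=> M; rewrite ?B1 ?B1' mulmx1 mul1mx.
pose B := tens_family (bs j) (bs h) eX eY eV eW eX' eY' eV' eW'.
have [G GB] : exists G, G *m B = 1%:M.
  exists (tens_cofamily (bs j) (bs h) eX^T eY^T eV^T eW^T eX'^T eY'^T eV'^T eW'^T).
  by apply: tens_cofamilyP; rewrite ?nz // ?C1 ?C1' mul1mx.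
have BG : B *m G = 1%:M by apply: mulmx1_eqdim GB; rewrite tens_dim.
have trGB : B^T *m G^T = 1%:M by rewrite -trmx_mul GB trmx1.
have trBG : G^T *m B^T = 1%:M by rewrite -trmx_mul BG trmx1.
exists (conj_module (tensor Lj Lh) trGB trBG); split; last exact: conj_module_iso.
split=> //; first by rewrite ltn_mod (leq_ltn_trans _ l_gt1).
- apply: (conj_module_tr _ _ (M := L_s xi p q r *t L_s xi p' q' r')).
    by rewrite tensor_s Ls Ls' -trmx_tens.
  rewrite trmxK; apply: tens_family_s (std _) (std' _).
  exact: prim_expr_order xi_prim.
- apply: (conj_module_tr _ _ (M := L_t zeta j (bs j) p q r *t L_t zeta h (bs h) p' q' r')).
    by rewrite tensor_t Lt Lt' -trmx_tens.
  by rewrite trmxK; apply: tens_family_t (std _) (std' _).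
- apply: (conj_module_tr _ _ (M := L_a0 zeta j (bs j) m *t 1%:M
                + L_t zeta j (bs j) p q r *t L_a0 zeta h (bs h) m')).
    rewrite tensor_a /Ag oppr0 expr0 mul1r La La' Lt [RHS]linearD /=.
    by rewrite !trmx_tens trmx1.
  by rewrite trmxK; apply: tens_family_a0 (std _) (std _) (std' _); rewrite ?nz.
Qed.
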